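(* Let $m\ge 3$, $n\ge 2$, let $C_m$ be the cycle on $m$ vertices and $P_n$ the path on $n$ vertices, and let $\Delta$ be the maximum degree of $C_m\times P_n$. Then $\chi''_{\Sigma}(C_m\times P_n)=\Delta+2$.
   Context: All graphs are finite and simple. A proper total $k$-coloring of a graph $G$ assigns to every vertex and every edge a color from $\{1,\dots,k\}$ such that adjacent vertices receive different colors, edges sharing an endpoint receive different colors, and no edge receives the same color as either of its endpoints. For such a coloring $c$ and a vertex $v$, let $f(v)=c(v)+\sum_{e\ni v} c(e)$. The coloring distinguishes adjacent vertices by sums if $f(u)\neq f(v)$ for every edge $uv$. $\chi''_{\Sigma}(G)$ denotes the smallest $k$ such that $G$ has a proper total $k$-coloring distinguishing adjacent vertices by sums. The product $G_1\times G_2$ is the Cartesian product: vertex set $V(G_1)\times V(G_2)$, with $(u_1,u_2)$ adjacent to $(v_1,v_2)$ iff either $u_1=v_1$ and $u_2v_2\in E(G_2)$, or $u_1v_1\in E(G_1)$ and $u_2=v_2$. *)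

(* Defs.v *)
From mathcomp Require Import all_boot.
Set Implicit Arguments.
Unset Strict Implicit.
Unset Printing Implicit Defensive.

Record sgraph := SGraph {
  vertex :> finType;
  adj : rel vertex;
  adj_sym : symmetric adj;
  adj_irr : irreflexive adj
}.

Definition edges (G : sgraph) : {set {set G}} :=
  [set [set p.1; p.2] | p : G * G & adj p.1 p.2].

Definition degree (G : sgraph) (v : G) : nat := #|[set u | adj v u]|.

Definition max_degree (G : sgraph) : nat := \max_(v : G) degree v.

Section Cycle.
Variable m : nat.
(* The conjunct [i != j] only matters for m = 1, where it removes the loop. *)
Definition cycle_adj (i j : 'I_m) : bool :=
  (i != j) && ((i.+1 %% m == j) || (j.+1 %% m == i)).
Lemma cycle_adj_sym : symmetric cycle_adj.
Proof. by move=> i j; rewrite /cycle_adj eq_sym orbC. Qed.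
Lemma cycle_adj_irr : irreflexive cycle_adj.
Proof. by move=> i; rewrite /cycle_adj eqxx. Qed.
Definition cycle_graph : sgraph := SGraph cycle_adj_sym cycle_adj_irr.
End Cycle.

Section Path.
Variable n : nat.
Definition path_adj (i j : 'I_n) : bool := (i.+1 == j) || (j.+1 == i).
Lemma path_adj_sym : symmetric path_adj.
Proof. by move=> i j; rewrite /path_adj orbC. Qed.
Lemma path_adj_irr : irreflexive path_adj.
Proof. by move=> i; rewrite /path_adj orbb gtn_eqF. Qed.
Definition path_graph : sgraph := SGraph path_adj_sym path_adj_irr.
End Path.

Section CartesianProduct.
Variables G1 G2 : sgraph.
Definition cart_adj (u v : G1 * G2) : bool :=
  (u.1 == v.1) && adj u.2 v.2 || adj u.1 v.1 && (u.2 == v.2).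
Lemma cart_adj_sym : symmetric cart_adj.
Proof.
by move=> u v; rewrite /cart_adj (eq_sym u.1) (eq_sym u.2) !(adj_sym u.1, adj_sym u.2).
Qed.
Lemma cart_adj_irr : irreflexive cart_adj.
Proof. by move=> u; rewrite /cart_adj !adj_irr andbF. Qed.
Definition cart_prod : sgraph := SGraph cart_adj_sym cart_adj_irr.
End CartesianProduct.

Section TotalColoring.
Variable G : sgraph.

(* A total coloring is a pair (cV, cE); the values of cE on sets of vertices
   that are not edges of G are irrelevant. *)
Definition proper_total_coloring (k : nat) (cV : G -> nat)
    (cE : {set G} -> nat) : bool :=
  [&& [forall v, 1 <= cV v <= k],
      [forall e in edges G, 1 <= cE e <= k],
      [forall u, forall v, adj u v ==> (cV u != cV v)],
      [forall e in edges G, forall e' in edges G,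
         (e != e') && (e :&: e' != set0) ==> (cE e != cE e')]
    & [forall e in edges G, forall v in e, cE e != cV v]].

Definition total_sum (cV : G -> nat) (cE : {set G} -> nat) (v : G) : nat :=
  cV v + \sum_(e in edges G | v \in e) cE e.

Definition sum_distinguishing (cV : G -> nat) (cE : {set G} -> nat) : bool :=
  [forall u, forall v, adj u v ==> (total_sum cV cE u != total_sum cV cE v)].

(* Colors range over 'I_k.+1, the color 0 being excluded by
   [proper_total_coloring], so that the search space is finite. *)
Definition sum_total_colorable (k : nat) : bool :=
  [exists cV : {ffun G -> 'I_k.+1}, exists cE : {ffun {set G} -> 'I_k.+1},
     proper_total_coloring k (fun v => cV v) (fun e => cE e)
     && sum_distinguishing (fun v => cV v) (fun e => cE e)].

Lemma eq_proper_total_coloring k cV cV' cE cE' :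
    cV =1 cV' -> {in edges G, cE =1 cE'} ->
  proper_total_coloring k cV cE -> proper_total_coloring k cV' cE'.
Proof.
move=> eV eE /and5P[/forallP h1 /forall_inP h2 /forallP h3 /forall_inP h4].
move=> /forall_inP h5; apply/and5P; split.
- by apply/forallP => v; rewrite -eV.
- by apply/forall_inP => e eG; rewrite -eE ?h2.
- by apply/forallP => u; apply/forallP => v; rewrite -!eV; have /forallP := h3 u.
- apply/forall_inP => e eG; apply/forall_inP => e' e'G.
  by rewrite -!eE //; have /forall_inP := h4 _ eG; apply.
- apply/forall_inP => e eG; apply/forall_inP => v ve.
  by rewrite -eE // -eV; have /forall_inP := h5 _ eG; apply.
Qed.

Lemma eq_sum_distinguishing cV cV' cE cE' :
    cV =1 cV' -> {in edges G, cE =1 cE'} ->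
  sum_distinguishing cV cE -> sum_distinguishing cV' cE'.
Proof.
move=> eV eE /forallP h; apply/forallP => u; apply/forallP => v.
have eS w : total_sum cV' cE' w = total_sum cV cE w.
  rewrite /total_sum eV; congr (_ + _).
  by apply: eq_bigr => e /andP[eG _]; rewrite eE.
by rewrite !eS; have /forallP := h u.
Qed.

Lemma sum_total_colorableP k :
  reflect (exists cV cE, proper_total_coloring k cV cE /\ sum_distinguishing cV cE)
          (sum_total_colorable k).
Proof.
apply: (iffP existsP) => [[cV /existsP[cE /andP[pc sd]]]|[cV [cE [pc sd]]]].
  by exists (fun v => cV v : nat), (fun e => cE e : nat).
have [/forallP h1 /forall_inP h2 _ _ _] := and5P pc.
pose dV := [ffun v => inord (cV v) : 'I_k.+1].
pose dE := [ffun e => inord (cE e) : 'I_k.+1].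
have eV : cV =1 (fun v => dV v : nat) by move=> v; rewrite ffunE inordK //; case/andP: (h1 v).
have eE : {in edges G, cE =1 (fun e => dE e : nat)}.
  by move=> e eG; rewrite ffunE inordK //; case/andP: (h2 e eG).
exists dV; apply/existsP; exists dE.
by rewrite (eq_proper_total_coloring eV eE pc) (eq_sum_distinguishing eV eE sd).
Qed.

Lemma sum_total_colorable_ex : exists k, sum_total_colorable k.
Proof.
pose cE (e : {set G}) := (enum_rank e).+1.
pose M := (\sum_(e : {set G}) cE e).+1.
have cE_ltM e : cE e < M by rewrite ltnS (bigD1 e) //= leq_addr.
pose cV (v : G) := (enum_rank v).+1 * M.
have M_le v : M <= cV v by rewrite leq_pmull.
exists (#|G| * M); apply/sum_total_colorableP; exists cV, cE.
have sE v : total_sum cV cE v %/ M = (enum_rank v).+1.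
  rewrite divnMDl // divn_small ?addn0 // ltnS [leqRHS](bigID
    (fun e => (e \in edges G) && (v \in e))) /=; exact: leq_addr.
have eqV (u v : G) : adj u v -> (enum_rank u).+1 != (enum_rank v).+1.
  rewrite eqSS; apply: contraTneq => /ord_inj/enum_rank_inj ->.
  by rewrite adj_irr.
have cV_le v : cV v <= #|G| * M by rewrite leq_mul2r ltn_ord orbT.
split; last first.
  apply/forallP => u; apply/forallP => v; apply/implyP => uv.
  by move: (eqV _ _ uv); rewrite -!sE; apply: contraNneq => /= ->.
apply/and5P; split.
- by apply/forallP => v; rewrite cV_le (leq_trans _ (M_le v)).
- apply/forall_inP => e /imsetP[[u v] _ _] /=.
  by apply: leq_trans (ltnW (cE_ltM e)) (leq_trans (M_le u) (cV_le u)).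
- apply/forallP => u; apply/forallP => v; apply/implyP => uv.
  by rewrite eqn_pmul2r // eqV.
- apply/forall_inP => e _; apply/forall_inP => e' _; apply/implyP => /andP[ne _].
  by apply: contraNneq ne => -[/ord_inj/enum_rank_inj ->].
- apply/forall_inP => e _; apply/forall_inP => v _.
  by rewrite ltn_eqF // (leq_trans (cE_ltM e)).
Qed.

Definition sum_total_chromatic : nat := ex_minn sum_total_colorable_ex.

End TotalColoring.

(* Main.v *)
(* Lower bound: with Delta + 1 colors a vertex of degree Delta sees every color, so two
   adjacent vertices of degree Delta have the same sum.

   Upper bound: for m >= 4 the cycle C_m has a total coloring in 1..4 in which both the
   vertex colors and the colors missing at the vertices differ along each edge. Use it on
   every row, exchanging the vertex color and the missing color on every other row, and
   color the edges between consecutive rows alternately 5 and 6. Sums of neighbors in the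
   same row, or in two rows of the same degree, differ by their missing colors; a vertex
   of degree 3 has sum at most 15 and one of degree 4 has sum at least 17. *)

Require Import Defs.
From mathcomp Require Import all_boot zify.
Set Implicit Arguments.
Unset Strict Implicit.
Unset Printing Implicit Defensive.

(** * Total colorings in terms of adjacency, and the lower bound *)

Section SumTotalColoring.
Variable G : sgraph.
Implicit Types (u v w : G) (cV : G -> nat) (cE : {set G} -> nat) (k : nat).

Lemma edgesP (e : {set G}) :
  reflect (exists u v, adj u v /\ e = [set u; v]) (e \in edges G).
Proof.
apply: (iffP imsetP) => [[[u v]]|[u [v [uv ->]]]].
  by rewrite inE /= => uv ->; exists u, v.
by exists (u, v); rewrite ?inE.
Qed.

Lemma mem_edges u v : adj u v -> [set u; v] \in edges G.
Proof. by move=> uv; apply/edgesP; exists u, v. Qed.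

Lemma edges_at (e : {set G}) v :
  e \in edges G -> v \in e -> exists2 u, adj v u & e = [set v; u].
Proof.
case/edgesP=> a [b [ab ->]]; rewrite !inE => /orP[]/eqP->; first by exists b.
by exists a; rewrite ?[[set b; a]]setUC // adj_sym.
Qed.

Lemma adj_neq u v : adj u v -> u != v.
Proof. by apply: contraTneq => ->; rewrite adj_irr. Qed.

Lemma set2_injr v u u' : u != v -> [set v; u] = [set v; u'] -> u = u'.
Proof.
move=> uv /setP/(_ u); rewrite !inE eqxx orbT (negPf uv) /=.
by move/esym/eqP.
Qed.

Lemma total_sumE cV cE v :
  total_sum cV cE v = cV v + \sum_(u | adj v u) cE [set v; u].
Proof.
rewrite /total_sum; congr (_ + _).
have -> : \sum_(u | adj v u) cE [set v; u] = \sum_(u in [set u | adj v u]) cE [set v; u].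
  by apply: eq_bigl => u; rewrite inE.
rewrite -(big_imset (h := fun u => [set v; u]) cE) /= => [|u u'].
  apply: eq_bigl => e; apply/andP/imsetP => [[eG ve]|[u]].
    by have [u vu ->] := edges_at eG ve; exists u; rewrite ?inE.
  by rewrite inE => vu ->; rewrite mem_edges ?set21.
rewrite !inE => vu _; apply: set2_injr.
by rewrite eq_sym adj_neq.
Qed.

(** Edge colors are given as a symmetric function on ordered adjacent pairs, so that concrete
    colorings never mention edges as sets. *)
Lemma sum_total_colorable_adj k cV (c : G -> G -> nat) :
    (forall v, 1 <= cV v <= k) ->
    (forall u v, adj u v -> 1 <= c u v <= k) ->
    (forall u v, adj u v -> c u v = c v u) ->
    (forall u v, adj u v -> cV u != cV v) ->
    (forall u v, adj u v -> c u v != cV u) ->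
    (forall u v w, adj u v -> adj u w -> v != w -> c u v != c u w) ->
    (forall u v, adj u v ->
       cV u + \sum_(w | adj u w) c u w != cV v + \sum_(w | adj v w) c v w) ->
  sum_total_colorable G k.
Proof.
move=> cV_k c_k c_sym cVV cEV cEE cS.
(* An arbitrary orientation of the edge is picked; the symmetry of [c] makes the choice harmless,
   and 0 is a junk value off the edges. *)
pose cE (e : {set G}) :=
  if [pick p : G * G | adj p.1 p.2 && (e == [set p.1; p.2])] is Some p
  then c p.1 p.2 else 0.
have cE_c u v : adj u v -> cE [set u; v] = c u v.
  move=> uv; rewrite /cE; case: pickP => [[a b] /= /andP[ab /eqP eq_ab]|]; last first.
    by move/(_ (u, v)); rewrite /= uv eqxx.
  have := set21 u v; rewrite eq_ab !inE => /orP[]/eqP ua; subst.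
    by rewrite (set2_injr _ eq_ab) // eq_sym adj_neq.
  rewrite [RHS]c_sym //; congr (c _ _); apply: (@set2_injr b).
    by rewrite adj_neq.
  by rewrite [LHS]setUC -eq_ab.
apply/sum_total_colorableP; exists cV, cE; split; last first.
  apply/forallP => u; apply/forallP => v; apply/implyP => uv; rewrite !total_sumE.
  have eS x : \sum_(w | adj x w) cE [set x; w] = \sum_(w | adj x w) c x w.
    by apply: eq_bigr => w; exact: cE_c.
  by rewrite !eS cS.
apply/and5P; split.
- exact/forallP.
- by apply/forall_inP => e /edgesP[u [v [uv ->]]]; rewrite cE_c ?c_k.
- by apply/forallP => u; apply/forallP => v; apply/implyP; exact: cVV.
- apply/forall_inP => e eG; apply/forall_inP => e' e'G; apply/implyP.
  case/andP=> ne /set0Pn[x]; rewrite inE => /andP[xe xe'].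
  have [u xu eu] := edges_at eG xe; have [v xv ev] := edges_at e'G xe'.
  rewrite eu ev !cE_c ?cEE //.
  by apply: contraNneq ne => uv; rewrite eu ev uv.
- apply/forall_inP => e eG; apply/forall_inP => x xe.
  by have [u xu ->] := edges_at eG xe; rewrite cE_c ?cEV.
Qed.

(* A vertex of degree [k.-1] sees each of the [k] colors exactly once, so its sum does
   not depend on the vertex. *)
Lemma total_sum_saturated k cV cE v :
    proper_total_coloring k cV cE ->
  degree v < k /\
  (k = (degree v).+1 -> total_sum cV cE v = \sum_(i < k.+1 | i != ord0) i).
Proof.
case/and5P=> /forallP V_k /forall_inP E_k _ /forall_inP EE /forall_inP EV.
pose N := [set u | adj v u].
have vN : v \notin N by rewrite inE adj_irr.
(* Properness at [v] amounts to [g] being injective on the closed neighborhood and never 0. *)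
pose g u : 'I_k.+1 := inord (if u == v then cV v else cE [set v; u]).
have gv : g v = cV v :> nat by rewrite /g eqxx inordK //; case/andP: (V_k v).
have gN u : adj v u -> g u = cE [set v; u] :> nat.
  move=> vu; rewrite /g eq_sym (negPf (adj_neq vu)) inordK //.
  by case/andP: (E_k _ (mem_edges vu)).
have neqVE u : adj v u -> g v <> g u.
  move=> vu /(congr1 val); rewrite /= gv gN //.
  have /forall_inP/(_ v (set21 _ _)) := EV _ (mem_edges vu).
  by rewrite eq_sym => /eqP.
have g_inj : {in v |: N &, injective g}.
  move=> u w; rewrite !inE => /orP[/eqP->|vu] /orP[/eqP->|vw] //.
  - by move/(neqVE _ vw).
  - by move/esym/(neqVE _ vu).
  move/(congr1 val); rewrite /= !gN // => eq_uw.
  apply/eqP; apply: contraT => uw.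
  have /forall_inP/(_ _ (mem_edges vw)) := EE _ (mem_edges vu).
  rewrite eq_uw eqxx implybF negb_and negbK => /orP[/eqP/set2_injr euw|].
    by rewrite euw ?eqxx // eq_sym adj_neq in uw.
  by rewrite negbK => /eqP/setP/(_ v); rewrite !inE eqxx.
have gS : g @: (v |: N) \subset [set~ ord0].
  apply/subsetP => _ /imsetP[u uN ->]; rewrite !inE -val_eqE /= -lt0n.
  move: uN; rewrite !inE => /orP[/eqP->|vu]; first by rewrite gv; case/andP: (V_k v).
  by rewrite gN //; case/andP: (E_k _ (mem_edges vu)).
have cN : #|g @: (v |: N)| = (degree v).+1.
  by rewrite card_in_imset // cardsU1 vN.
have c0 : #|[set~ ord0 : 'I_k.+1]| = k by rewrite cardsC1 card_ord.
(* The image has [(degree v).+1] elements among the [k] nonzero colors; equality forces it to be all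
   of them. *)
have := subset_leq_card gS; rewrite cN c0 => dk; split=> // kE.
have gE : g @: (v |: N) = [set~ ord0].
  by apply/eqP; rewrite eqEcard gS cN c0 kE /=.
rewrite total_sumE.
have -> : \sum_(i < k.+1 | i != ord0) i = \sum_(i in [set~ ord0 : 'I_k.+1]) i.
  by apply: eq_bigl => i; rewrite !inE.
rewrite -gE big_imset //= big_setU1 //= gv; congr (_ + _).
by apply: eq_big => [u|u vu]; rewrite ?inE // gN.
Qed.

Lemma sum_total_colorable_adj_degree k u v :
  adj u v -> degree u = degree v -> sum_total_colorable G k -> degree u + 2 <= k.
Proof.
move=> uv duv /sum_total_colorableP[cV [cE [pc /forallP/(_ u)/forallP/(_ v)]]].
have [du su] := total_sum_saturated u pc; have [dv sv] := total_sum_saturated v pc.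
rewrite uv /= addn2 ltn_neqAle du andbT; apply: contraNneq => ku.
by rewrite su // sv // -duv.
Qed.

Lemma sum_total_chromatic_eq k :
    sum_total_colorable G k -> (forall l, sum_total_colorable G l -> k <= l) ->
  sum_total_chromatic G = k.
Proof.
move=> Gk k_min; rewrite /sum_total_chromatic; case: ex_minnP => l Gl l_min.
by apply/eqP; rewrite eqn_leq l_min // k_min.
Qed.

End SumTotalColoring.

(** * Successor and predecessor in the cyclic order *)

Lemma ordS_neq m (i : 'I_m) : 1 < m -> ordS i != i.
Proof.
move=> m1; rewrite -val_eqE /=; have [im|] := ltnP i.+1 m.
  by rewrite modn_small //; lia.
by move=> mi; have -> : i.+1 = m; [have := ltn_ord i; lia | rewrite modnn; lia].
Qed.

Lemma ordS2_neq m (i : 'I_m) : 2 < m -> ordS (ordS i) != i.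
Proof.
move=> m2; rewrite -val_eqE /=; have [im|mi] := ltnP i.+1 m.
  rewrite (modn_small im); have [im'|mi'] := ltnP i.+2 m.
    by rewrite modn_small //; lia.
  by have -> : i.+2 = m; [lia | rewrite modnn; lia].
have -> : i.+1 = m by have := ltn_ord i; lia.
by rewrite modnn modn_small; lia.
Qed.

Lemma ordS_neq_ord_pred m (i : 'I_m) : 2 < m -> ordS i != ord_pred i.
Proof. by move=> m2; rewrite -(inj_eq (can_inj (@ordSK m))) ord_predK ordS2_neq. Qed.

(** * Neighborhoods, degrees and colorings of the product *)

Section CyclePath.
Variables m n : nat.
Hypothesis m_gt2 : 2 < m.
Local Notation G := (cart_prod (cycle_graph m) (path_graph n)).

Lemma cycle_adjE (i j : 'I_m) : cycle_adj i j = (j == ordS i) || (j == ord_pred i).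
Proof.
have SE : (i.+1 %% m == j) = (j == ordS i) by rewrite eq_sym -val_eqE.
have -> : (j == ord_pred i) = (j.+1 %% m == i).
  by rewrite -(inj_eq (can_inj (@ordSK m))) ord_predK -val_eqE.
rewrite /cycle_adj SE andbC; have [|] := boolP (_ || _) => //= h.
apply: contraTneq h => ->.
by rewrite negb_or eq_sym ordS_neq ?(ltnW m_gt2) //= -(val_eqE (ordS j)) ordS_neq // ltnW.
Qed.

(** [F] takes the row as a natural number, so the terms beyond the two end rows make sense and are
    cancelled by a zero factor. *)
Lemma sum_cycle_path_nbr (F : 'I_m -> nat -> nat) (u : G) :
  \sum_(w : G | adj u w) F w.1 w.2 =
    F (ordS u.1) u.2 + F (ord_pred u.1) u.2
    + (u.2.+1 < n) * F u.1 u.2.+1 + (0 < u.2) * F u.1 u.2.-1.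
Proof.
case: u => j i /=.
have SP := ordS_neq_ord_pred j m_gt2.
(* The four directions are mutually exclusive, so adjacency is the sum of their indicators; the
   vertical ones compare rows in [nat], as the neighbor may not exist. *)
pose P1 (w : 'I_m * 'I_n) := w == (ordS j, i).
pose P2 (w : 'I_m * 'I_n) := w == (ord_pred j, i).
pose P3 (w : 'I_m * 'I_n) := (w.1 == j) && (i.+1 == w.2).
pose P4 (w : 'I_m * 'I_n) := (w.1 == j) && (w.2.+1 == i).
have PE (w : 'I_m * 'I_n) :
    cart_adj (G1 := cycle_graph m) (G2 := path_graph n) (j, i) w
    = P1 w + P2 w + P3 w + P4 w :> nat.
  case: w => j' i'; rewrite /P1 /P2 /P3 /P4 /cart_adj /= !xpair_eqE.
  rewrite cycle_adjE (eq_sym i i') (eq_sym j j') /path_adj.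
  have [->|_] := eqVneq i' i.
    have -> : i.+1 == i = false by lia.
    rewrite /= !andbF !andbT /=.
    by have [->|_] := eqVneq j' (ordS j); rewrite ?(negPf SP) ?addn0.
  rewrite !andbF orbF; case: (j' == j) => //=.
  by rewrite add0n; lia.
rewrite big_mkcond /=.
rewrite (eq_bigr (fun w : 'I_m * 'I_n => (if P1 w then F w.1 w.2 else 0)
  + (if P2 w then F w.1 w.2 else 0) + (if P3 w then F w.1 w.2 else 0)
  + (if P4 w then F w.1 w.2 else 0))); last first.
  move=> w _; move: (PE w); case: (cart_adj _ _); case: (P1 w); case: (P2 w);
  case: (P3 w); case: (P4 w) => //=; lia.
rewrite !big_split -!big_mkcond /= !big_pred1_eq /=; congr (_ + _ + _ + _).
  have [lt_in|ge_in] := ltnP i.+1 n.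
    rewrite (big_pred1 (j, Ordinal lt_in)) ?mul1n // => -[j' i'].
    by rewrite /P3 /= xpair_eqE -(val_eqE i') (eq_sym (val i')).
  by rewrite big_pred0 // => -[j' i']; rewrite /P3 /=; have := ltn_ord i'; lia.
have [i0|i_gt0] := posnP i.
  by rewrite big_pred0 // => -[j' i']; rewrite /P4 /=; lia.
have lt_in : i.-1 < n by have := ltn_ord i; lia.
rewrite (big_pred1 (j, Ordinal lt_in)) ?mul1n // => -[j' i'].
by rewrite /P4 /= xpair_eqE -(val_eqE i') /=; congr (_ && _); lia.
Qed.

Lemma cycle_path_degree (u : G) : degree u = 2 + (u.2.+1 < n) + (0 < u.2).
Proof.
rewrite /degree -sum1_card; under eq_bigl do rewrite inE.
by rewrite (sum_cycle_path_nbr (fun _ _ => 1)) !muln1.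
Qed.

Lemma cycle_path_max_degree : 1 < n -> max_degree G = 3 + (2 < n).
Proof.
move=> n_gt1; have m_gt0 : 0 < m by lia.
apply/eqP; rewrite eqn_leq; apply/andP; split.
  by apply/bigmax_leqP => -[j i] _; rewrite cycle_path_degree /=; have := ltn_ord i; lia.
pose u : G := (Ordinal m_gt0, Ordinal n_gt1).
by apply: leq_trans (leq_bigmax u); rewrite cycle_path_degree /=; lia.
Qed.

(** Up to symmetry, every edge goes to the cyclic successor or to the next row. *)
Lemma cycle_path_adj_ind (X : G -> G -> Prop) :
    (forall u v, X u v -> X v u) ->
    (forall (j : 'I_m) (i : 'I_n), X (j, i) (ordS j, i)) ->
    (forall (j : 'I_m) (i i' : 'I_n), i' = i.+1 :> nat -> X (j, i) (j, i')) ->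
  forall u v, adj u v -> X u v.
Proof.
move=> X_sym XS XP [j i] [j' i']; rewrite /= /cart_adj /= cycle_adjE.
case/orP=> /andP[].
  move=> /eqP<- /orP[]/eqP e; first exact: XP.
  by apply: X_sym; exact: XP.
move=> /orP[]/eqP-> /eqP<-; first exact: XS.
by apply: X_sym; have := XS (ord_pred j) i; rewrite ord_predK.
Qed.

(* [v i j] and [h i j] color the vertex [(j, i)] and the edge from it to [(ordS j, i)];
   [w i j] colors the edge from [(j, i.-1)] to [(j, i)], and is also defined for the
   missing edges [i = 0] and [i = n] so that properness is uniform in [i]. *)
Lemma cycle_path_colorable k (v h w : nat -> 'I_m -> nat)
    (f := fun i j => v i j + (h i j + h i (ord_pred j)
                              + (i.+1 < n) * w i.+1 j + (0 < i) * w i j)) :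
    (forall i j, 1 <= v i j <= k) -> (forall i j, 1 <= h i j <= k) ->
    (forall i j, 0 < i < n -> 1 <= w i j <= k) ->
    (forall i j, uniq [:: v i j; h i j; h i (ord_pred j); w i j; w i.+1 j]) ->
    (forall i j, v i j != v i (ordS j)) -> (forall i j, v i j != v i.+1 j) ->
    (forall i j, i < n -> f i j != f i (ordS j)) ->
    (forall i j, i.+1 < n -> f i j != f i.+1 j) ->
  sum_total_colorable G k.
Proof.
move=> v_k h_k w_k vhw vr vc fr fc.
(* Within a row an edge is indexed by its tail, which is [j'] when [j'] is the predecessor of [j];
   between rows, by its end in the larger row, as for [w]. *)
pose C (j : 'I_m) (i : nat) (j' : 'I_m) (i' : nat) :=
  if i' == i then if j' == ordS j then h i j else h i j' else w (maxn i i') j.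
pose c (a b : G) := C a.1 a.2 b.1 b.2.
have SP (j : 'I_m) : (ord_pred j == ordS j) = false.
  by rewrite eq_sym; exact: negbTE (ordS_neq_ord_pred j m_gt2).
have CS j i : C j i (ordS j) i = h i j by rewrite /C !eqxx.
have CP j i : C j i (ord_pred j) i = h i (ord_pred j) by rewrite /C !eqxx SP.
have CU j i : C j i j i.+1 = w i.+1 j.
  by rewrite /C ifN; [congr w|]; lia.
have CD j i : 0 < i -> C j i j i.-1 = w i j.
  by move=> i0; rewrite /C ifN; [congr w|]; lia.
have c_sym : forall a b, adj a b -> c a b = c b a.
  apply: cycle_path_adj_ind => [a b -> //|j i|j i i' ei].
    by rewrite /c /= CS; have := CP (ordS j) i; rewrite ordSK.
  by rewrite /c /= ei CU; have := CD j i.+1 isT.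
have sumE (a : G) : v a.2 a.1 + \sum_(b | adj a b) c a b = f a.2 a.1.
  rewrite (sum_cycle_path_nbr (C a.1 a.2)) CS CP CU /f; do 2!congr (_ + _).
  by case: posnP => // i0; rewrite CD.
(* [col] and [dst] list the four directions in the same order: distinct neighbors lie in distinct
   directions, whose colors differ by [vhw]. *)
pose col (a : G) := [:: h a.2 a.1; h a.2 (ord_pred a.1); w a.2 a.1; w a.2.+1 a.1].
pose dst (a : G) :=
  [:: (ordS a.1, a.2 : nat); (ord_pred a.1, a.2 : nat); (a.1, a.2.-1); (a.1, a.2.+1)].
have dirP (a b : G) : adj a b -> exists d, [/\ d < 4,
    (b.1, b.2 : nat) = nth (a.1, 0) (dst a) d & c a b = nth 0 (col a) d].
  case: a b => [j i] [j' i'] /=; rewrite /cart_adj /= cycle_adjE.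
  case/orP=> /andP[].
    move=> /eqP<- /orP[]/eqP ei; [exists 3 | exists 2]; split=> //=.
    - by rewrite ei.
    - by rewrite /c /= -ei CU.
    - by rewrite -ei.
    - by rewrite /c /= -CD -?ei.
  move=> /orP[]/eqP-> /eqP<-; [exists 0 | exists 1]; split=> //=.
  - by rewrite /c CS.
  - by rewrite /c CP.
apply: (@sum_total_colorable_adj G k (fun a : G => v a.2 a.1) c) => //.
(* The range condition on [c a b] is symmetric only through [c_sym], so that equality is carried
   into the induction as a premise. *)
- move=> a b ab; have := c_sym a b ab; move: a b ab.
  apply: cycle_path_adj_ind => [a b ab e|j i _|j i i' ei _].
  + by rewrite e ab.
  + by rewrite /c CS.
  + by rewrite /c ei CU w_k //=; have := ltn_ord i'; lia.
- by apply: cycle_path_adj_ind => [a b|j i|j i i' ->] //=; rewrite eq_sym.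
- move=> a b ab; have [d [d4 _ ->]] := dirP a b ab.
  have /= /andP[nv _] := vhw a.2 a.1.
  by apply: contraNneq nv => <-; apply: (mem_nth 0 (s := col a)).
- move=> a b b' ab ab' nbb'.
  have [d [d4 db ->]] := dirP a b ab; have [d' [d4' db' ->]] := dirP a b' ab'.
  have /= /andP[_ u4] := vhw a.2 a.1.
  rewrite (@nth_uniq _ 0 (col a)) //; apply: contraNneq nbb' => edd.
  move: db; rewrite edd -db'; case: b b' {ab ab' db'} => [j i] [j' i'] /= [-> ei].
  by apply/eqP; congr (_, _); apply: ord_inj.
- move=> a b ab; rewrite !sumE; move: a b ab.
  apply: cycle_path_adj_ind => [a b|j i|j i i' ei] /=.
  + by rewrite eq_sym.
  + exact: fr.
  + by rewrite ei fc // -ei.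
Qed.

End CyclePath.

(** * Explicit colorings: from the cycle for [m > 3], by patterns for the triangle *)

(* The edge to the next vertex, the vertex, and the color of [1..4] missing at it, in a
   sum-distinguishing total 4-coloring of the cycle. *)
Definition cycle4 (m j : nat) : nat * nat * nat :=
  if odd m && (m - 3 <= j) then
    nth (0, 0, 0) [:: (3, 2, 4); (4, 1, 2); (1, 2, 3)] (j - (m - 3))
  else if odd j then (1, 4, 3) else (2, 3, 4).

(** The edge colored [h] ends at the second vertex, so the permutation says that this vertex and its
    two edges use each color of 1..4 except [y']. *)
Definition cycle4_step (a b : nat * nat * nat) : bool :=
  let: (h, x, y) := a in let: (h', x', y') := b in
  [&& perm_eq [:: h; h'; x'; y'] [:: 1; 2; 3; 4], x != x' & y != y'].

(** For even [m] two triples alternate. For odd [m] the last three vertices break the alternation: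
    [m - 3] is even, so they follow [(1, 4, 3)] and precede [(2, 3, 4)]. At [m = 3] they would close
    on themselves, giving two neighbors the color 2. *)
Lemma cycle4P m (j : 'I_m) : 3 < m -> cycle4_step (cycle4 m j) (cycle4 m (ordS j)).
Proof.
move=> m_gt3; have jm := ltn_ord j; rewrite /cycle4 /=.
have [jm1|mj] := ltnP j.+1 m; last first.
  have e : j.+1 = m by lia.
  rewrite e modnn; case: (boolP (odd m)) => om /=.
    have -> : (m - 3 <= j) = true by lia.
    have -> : (m - 3 <= 0) = false by lia.
    by have -> : j - (m - 3) = 2 by lia.
  by have -> : odd j by lia.
rewrite modn_small //; case: (boolP (odd m)) => om /=; last by case: (odd j).
have [lt3|le3] := ltnP j.+1 (m - 3).
  have -> : (m - 3 <= j) = false by lia.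
  by case: (odd j).
have [e|] := eqVneq (m - 3) j.+1.
  have -> : (m - 3 <= j) = false by lia.
  have -> : j.+1 - (m - 3) = 0 by lia.
  by have -> : odd j by lia.
move=> ne; have -> : (m - 3 <= j) = true by lia.
have [[-> ->]|[-> ->] //] :
  j - (m - 3) = 0 /\ j.+1 - (m - 3) = 1 \/ j - (m - 3) = 1 /\ j.+1 - (m - 3) = 2 by lia.
by [].
Qed.

Lemma cycle_path_colorable_gt3 m n : 3 < m -> 1 < n ->
  sum_total_colorable (cart_prod (cycle_graph m) (path_graph n)) (5 + (2 < n)).
Proof.
move=> m_gt3 n_gt1.
pose h (j : 'I_m) := (cycle4 m j).1.1.
pose x (j : 'I_m) := (cycle4 m j).1.2.
pose y (j : 'I_m) := (cycle4 m j).2.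
have step j : [/\ perm_eq [:: h (ord_pred j); h j; x j; y j] [:: 1; 2; 3; 4],
                  x j != x (ordS j) & y j != y (ordS j)].
  have := cycle4P (ord_pred j) m_gt3; have := cycle4P j m_gt3.
  rewrite ord_predK /cycle4_step /h /x /y.
  case: (cycle4 m (ord_pred j)) => [[? ?] ?]; case: (cycle4 m j) => [[? ?] ?].
  by case: (cycle4 m (ordS j)) => [[? ?] ?] /= /and3P[_ -> ->] /and3P[].
(* As 1 + 2 + 3 + 4 = 10, the part of a sum inside a row is 10 minus the color missing there. *)
have sum10 j : h (ord_pred j) + (h j + (x j + y j)) = 10.
  by case: (step j) => /perm_sumn /=; rewrite !addn0.
have uniq4 j : uniq [:: h (ord_pred j); h j; x j; y j].
  by case: (step j) => /perm_uniq->.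
have le4 j : [/\ 1 <= h (ord_pred j) <= 4, 1 <= h j <= 4, 1 <= x j <= 4 & 1 <= y j <= 4].
  have : all (fun c => 1 <= c <= 4) [:: h (ord_pred j); h j; x j; y j].
    by case: (step j) => /perm_all->.
  by rewrite /= andbT => /and4P[].
pose v i j := if odd i then y j else x j.
(* [w 0] and [w n] color no edge. For [n = 2] only [w 1], of value 5, counts, so color 6 occurs only
   when [2 < n]. *)
pose w i (_ : 'I_m) := if odd i then 5 else 6.
apply: (@cycle_path_colorable _ _ _ _ v (fun=> h) w); first by lia.
all: move=> i j; rewrite /v /w /=.
all: case: (step j) => _ x_neq y_neq; case: (le4 j) => hp_4 h_4 x_4 y_4.
all: have := sum10 j; have := uniq4 j; rewrite /= !inE => /and4P[].
- by case: (odd i) => * /=; lia.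
- by move=> *; lia.
- by case: (boolP (odd i)) => oi *; lia.
- by case: (odd i) => * /=; lia.
- by case: (odd i) => * /=; lia.
- by case: (odd i) => * /=; lia.
- have := sum10 (ordS j); rewrite ordSK; case: (odd i) => * /=; lia.
- by case: (boolP (odd i)) => oi * /=; lia.
Qed.

(* A triangle has no sum-distinguishing total 4-coloring, so [m = 3] needs its own
   patterns; they were found by computer search. *)
Lemma cycle3_path_colorable_gt2 n : 2 < n ->
  sum_total_colorable (cart_prod (cycle_graph 3) (path_graph n)) 6.
Proof.
move=> n_gt2.
pose v i (j : 'I_3) := nth 0 (if odd i then [:: 2; 1; 3] else [:: 5; 4; 6]) j.
pose h i (j : 'I_3) := nth 0 (if odd i then [:: 4; 6; 1] else [:: 1; 3; 2]) j.
pose w i (j : 'I_3) := nth 0 (if odd i then [:: 6; 5; 4] else [:: 3; 2; 5]) j.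
apply: (@cycle_path_colorable _ _ _ _ v h w) => // i j;
  rewrite /v /h /w /=; case: j => [[|[|[|j]]] //= jlt]; case: (odd i) => //=; lia.
Qed.

Lemma cycle3_path2_colorable :
  sum_total_colorable (cart_prod (cycle_graph 3) (path_graph 2)) 5.
Proof.
pose v i (j : 'I_3) := nth 0 (if odd i then [:: 5; 4; 1] else [:: 2; 3; 4]) j.
pose h (_ : nat) (j : 'I_3) := nth 0 [:: 1; 2; 3] j.
(* Only [w 1] colors an edge; the 6, outside the palette, fills in for the missing edges [w 0] and
   [w 2]. *)
pose w i (j : 'I_3) := nth 0 (if odd i then [:: 4; 5; 5] else [:: 6; 6; 6]) j.
apply: (@cycle_path_colorable _ _ _ _ v h w) => // i j;
  rewrite /v /h /w /=; case: j => [[|[|[|j]]] //= jlt]; case: (boolP (odd i)) => //=; lia.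
Qed.

Theorem theorem4p2 (m n : nat) (hm : 3 <= m) (hn : 2 <= n) :
  sum_total_chromatic (cart_prod (cycle_graph m) (path_graph n)) =
  max_degree (cart_prod (cycle_graph m) (path_graph n)) + 2.
Proof.
rewrite cycle_path_max_degree // addnAC; apply: sum_total_chromatic_eq => [|k].
  have [m_gt3|m_le3] := ltnP 3 m; first exact: cycle_path_colorable_gt3.
  have -> : m = 3 by lia.
  have [n_gt2|n_le2] := ltnP 2 n; first exact: cycle3_path_colorable_gt2.
  have -> : n = 2 by lia.
  exact: cycle3_path2_colorable.
have m_gt0 : 0 < m by lia.
(* Row 1 has maximum degree in both cases: it is interior if [2 < n], and all degrees are 3 if
   [n = 2]. *)
pose i1 : 'I_n := Ordinal hn; pose j0 : 'I_m := Ordinal m_gt0.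
pose u : cart_prod (cycle_graph m) (path_graph n) := (j0, i1).
pose u' : cart_prod (cycle_graph m) (path_graph n) := (ordS j0, i1).
have uu' : adj u u' by rewrite /= /cart_adj /= cycle_adjE // !eqxx orbT.
have := @sum_total_colorable_adj_degree _ k u u' uu'; rewrite !cycle_path_degree //=.
by move=> /(_ erefl) kP /kP; lia.
Qed.
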